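(* Let $m>0$ and let $(M,g)$ be the Riemannian Schwarzschild manifold of mass $m$. Let $\Sigma_0=\{x\in M: x_3=0\}$ be the plane through the origin. Then the Morse index of $\Sigma_0$, with respect to variations that are tangential along $\partial M$, is exactly one.
   Context: For $m>0$ let $M=\{x\in\mathbb R^3: |x|\ge m/2\}$ with metric $g=(1+\frac{m}{2|x|})^4\delta$, $\delta$ the Euclidean metric; $\partial M=\{|x|=m/2\}$ is the horizon. $\Sigma_0$ is a totally geodesic free-boundary minimal surface (a topological annulus) meeting $\partial M$ orthogonally; any rotation of it is also called a plane through the origin. For a properly embedded free-boundary minimal surface $\Sigma$ with global unit normal $N$, define for smooth $u$ on $\Sigma$ $$Q(u,u)=\int_\Sigma\big(|\nabla_g u|_g^2-(\mathrm{Ric}_g(N,N)+|A_\Sigma|_g^2)u^2\big)\,dA_g+\int_{\partial\Sigma}A_{\partial M}(N,N)u^2\,ds_g,$$ where $A_\Sigma(V,W)=-g(\tilde\nabla_V N,W)$, $A_{\partial M}(V,W)=-g(\tilde\nabla_V\eta,W)$ with $\eta$ the outward unit normal of $\partial M$ and $\tilde\nabla$ the Levi-Civita connection of $g$. For $R>m/2$ let $\Sigma(R)=\Sigma\cap\{|x|\le R\}$ ($|x|$ Euclidean norm). The Morse index of $\Sigma(R)$ is the maximal dimension of a linear space $V$ of smooth functions on $\Sigma(R)$ vanishing on $\{|x|=R\}$ with $Q(u,u)<0$ for all $u\in V\setminus\{0\}$ (no condition is imposed on $\partial\Sigma\subset\partial M$). The Morse index of $\Sigma$ is the limit of the indices of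 $\Sigma(R)$ as $R\to\infty$. *)

(* Defs.v *)
From Stdlib Require Import Reals Lra.
From Coquelicot Require Import Coquelicot.
Open Scope R_scope.

(* ---------- Points of R^3 as functions nat -> R (indices 0,1,2) ---------- *)
Definition upd (p : nat -> R) (k : nat) (t : R) : nat -> R :=
  fun i => if Nat.eqb i k then t else p i.

Definition sum3 (f : nat -> R) : R := f 0%nat + f 1%nat + f 2%nat.

Definition norm3 (p : nat -> R) : R := sqrt (p 0%nat ^ 2 + p 1%nat ^ 2 + p 2%nat ^ 2).

Definition dpart (k : nat) (F : (nat -> R) -> R) (p : nat -> R) : R :=
  Derive (fun t => F (upd p k t)) (p k).

Definition phi (m : R) (p : nat -> R) : R := 1 + m / (2 * norm3 p).

Definition gmet (m : R) (i j : nat) (p : nat -> R) : R :=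
  if Nat.eqb i j then phi m p ^ 4 else 0.

Definition ginv (m : R) (i j : nat) (p : nat -> R) : R :=
  if Nat.eqb i j then / (phi m p ^ 4) else 0.

Definition gval (m : R) (p : nat -> R) (V W : nat -> R) : R :=
  sum3 (fun i => sum3 (fun j => gmet m i j p * V i * W j)).

Definition Gam (m : R) (k i j : nat) (p : nat -> R) : R :=
  / 2 * sum3 (fun l => ginv m k l p *
     (dpart i (gmet m j l) p + dpart j (gmet m i l) p - dpart l (gmet m i j) p)).

Definition Ric (m : R) (i j : nat) (p : nat -> R) : R :=
  sum3 (fun k => dpart k (Gam m k i j) p - dpart j (Gam m k i k) p
     + sum3 (fun l => Gam m k k l p * Gam m l i j p - Gam m k j l p * Gam m l i k p)).

Definition RicVW (m : R) (p : nat -> R) (V W : nat -> R) : R :=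
  sum3 (fun i => sum3 (fun j => Ric m i j p * V i * W j)).

Definition nabla (m : R) (V : nat -> R) (X : (nat -> R) -> nat -> R) (p : nat -> R)
  : nat -> R :=
  fun k => sum3 (fun i => V i * (dpart i (fun q => X q k) p
                                 + sum3 (fun j => Gam m k i j p * X p j))).

Definition pt (x y : R) : nat -> R :=
  fun i => match i with 0%nat => x | 1%nat => y | _ => 0 end.

(* global unit normal N = phi^{-2} e_3 of Sigma_0 *)
Definition Nfield (m : R) (p : nat -> R) : nat -> R :=
  fun k => if Nat.eqb k 2 then / (phi m p ^ 2) else 0.

(* outward unit normal of the horizon dM = {|x| = m/2} (outward from M = {|x|>=m/2}) *)
Definition eta (m : R) (p : nat -> R) : nat -> R :=
  fun k => - p k / (norm3 p * phi m p ^ 2).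

(* g-orthonormal tangent frame E_a = phi^{-2} e_a (a = 0,1) of Sigma_0 *)
Definition Eframe (m : R) (p : nat -> R) (a : nat) : nat -> R :=
  fun k => if Nat.eqb k a then / (phi m p ^ 2) else 0.

Definition ASigma (m : R) (p : nat -> R) (V W : nat -> R) : R :=
  - gval m p (nabla m V (Nfield m) p) W.

Definition normA2 (m : R) (p : nat -> R) : R :=
  ASigma m p (Eframe m p 0) (Eframe m p 0) ^ 2 + ASigma m p (Eframe m p 0) (Eframe m p 1) ^ 2
  + ASigma m p (Eframe m p 1) (Eframe m p 0) ^ 2 + ASigma m p (Eframe m p 1) (Eframe m p 1) ^ 2.

Definition AdM_NN (m : R) (p : nat -> R) : R :=
  - gval m p (nabla m (Nfield m p) (eta m) p) (Nfield m p).

Definition d1 (u : R -> R -> R) (x y : R) : R := Derive (fun t => u t y) x.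
Definition d2 (u : R -> R -> R) (x y : R) : R := Derive (fun t => u x t) y.

(* u is C^infinity: all iterated partial derivatives exist and are continuous *)
Definition smooth2 (u : R -> R -> R) : Prop :=
  exists S : (R -> R -> R) -> Prop, S u /\
   forall f, S f ->
     (forall x y, continuous (fun z : R * R => f (fst z) (snd z)) (x, y)) /\
     (forall x y, ex_derive (fun t => f t y) x /\ ex_derive (fun t => f x t) y) /\
     S (d1 f) /\ S (d2 f).

(* integrand of the interior part of Q, times the area density of g on Sigma_0
   (induced metric phi^4 (dx^2+dy^2): |grad u|_g^2 = phi^{-4}|Du|^2, dA_g = phi^4 dx dy) *)
Definition Qdens (m : R) (u : R -> R -> R) (x y : R) : R :=
  let p := pt x y in
  ( / (phi m p ^ 4) * (d1 u x y ^ 2 + d2 u x y ^ 2)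
    - (RicVW m p (Nfield m p) (Nfield m p) + normA2 m p) * u x y ^ 2 ) * phi m p ^ 4.

(* Q(u,u) on Sigma_0(R) = {m/2 <= |x| <= R, x_3 = 0}, integrals written in polar
   coordinates (x,y) = (r cos th, r sin th); the boundary dSigma = {r = m/2}
   has length element ds_g = phi^2 (m/2) dth. *)
Definition Qform (m Rad : R) (u : R -> R -> R) : R :=
  RInt (fun th => RInt (fun r => Qdens m u (r * cos th) (r * sin th) * r) (m / 2) Rad)
       0 (2 * PI)
  + RInt (fun th =>
       let x := m / 2 * cos th in let y := m / 2 * sin th in
       AdM_NN m (pt x y) * u x y ^ 2 * (phi m (pt x y) ^ 2 * (m / 2))) 0 (2 * PI).

Definition admissible (Rad : R) (u : R -> R -> R) : Prop :=
  smooth2 u /\ forall x y, x ^ 2 + y ^ 2 = Rad ^ 2 -> u x y = 0.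

Fixpoint lincomb (k : nat) (c : nat -> R) (u : nat -> R -> R -> R) (x y : R) : R :=
  match k with
  | O => 0
  | S k' => lincomb k' c u x y + c k' * u k' x y
  end.

(* there is a k-dimensional space of admissible functions on which Q is negative
   definite: spanned by u_0..u_{k-1}; Q(sum c_i u_i) < 0 for every nonzero
   coefficient vector (which also forces linear independence) *)
Definition index_at_least (m Rad : R) (k : nat) : Prop :=
  exists u : nat -> R -> R -> R,
    (forall i, (i < k)%nat -> admissible Rad (u i)) /\
    (forall c : nat -> R, (exists i, (i < k)%nat /\ c i <> 0) ->
       Qform m Rad (lincomb k c u) < 0).

Definition morse_index_R (m Rad : R) (k : nat) : Prop :=
  index_at_least m Rad k /\ ~ index_at_least m Rad (S k).

(* Morse index of Sigma_0 = lim_{R -> oo} index(Sigma_0(R)) equals k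
   (an integer-valued function of R has limit k iff it is eventually k) *)
Definition morse_index (m : R) (k : nat) : Prop :=
  exists R0, m / 2 < R0 /\ forall Rad, R0 <= Rad -> morse_index_R m Rad k.

(* Main.v *)
From Stdlib Require Import Reals Lra Lia.
From Coquelicot Require Import Coquelicot.
Require Import Defs.
Open Scope R_scope.

(** On the plane, [Ric(N,N) phi^4 = 4 m / (r (2 r + m)^2)] and both second fundamental
    forms vanish, so with [k = m/2] and [r = k e^(2s)]
    [Q(u) = int_0^(2 pi) int_0^S (1/2) (u_s^2 - 2 sech^2(s) u^2) + 2 u_th^2 ds dth].

    Index at most one: on the half-line the radial operator [-d^2/ds^2 - 2 sech^2 s], Neumann at
    [s = 0], has the single negative eigenvalue [-1], with eigenfunction [sech s] of norm one.
    Writing [a(th) = int_0^S u sech ds], an explicit sum-of-squares identity gives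
    [int_0^S (u_s^2 - 2 sech^2 u^2) ds >= - (1 - e^(-2S)) a^2], and Cauchy-Schwarz gives
    [int_0^S u_th^2 ds >= a'^2].  If [int_0^(2 pi) a = 0] then [int a'^2 >= (1/4) int a^2], whence
    [Q(u) >= 0].  This is one linear condition on [u], so [Q] is not negative definite on any
    two-dimensional space.

    Index at least one: [(R^2 - x^2 - y^2)^2] has [Q < 0] as soon as [R >= 40 k]. *)

(** * Curvature of the Schwarzschild metric along the plane *)

(* Coquelicot states equations in the carrier of [R_AbsRing], which [ring] and [lra] do not
   recognise as [R]. *)
Ltac eqR := match goal with |- @eq _ ?a ?b => change (@eq R a b) end.

Definition sq3 (p : nat -> R) : R := p 0%nat ^ 2 + p 1%nat ^ 2 + p 2%nat ^ 2.

(* The partial derivative of [ln (phi m)] in direction [i], away from the origin. *)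
Definition dlogphi (m : R) (i : nat) (p : nat -> R) : R :=
  - m * p i / (norm3 p ^ 2 * (2 * norm3 p + m)).

Definition delta (i j : nat) : R := if Nat.eqb i j then 1 else 0.

Lemma norm3_pos (p : nat -> R) : 0 < sq3 p -> 0 < norm3 p.
Proof. exact (sqrt_lt_R0 _). Qed.

Lemma norm3_sqr (p : nat -> R) : norm3 p ^ 2 = sq3 p.
Proof.
  unfold norm3, sq3; rewrite pow2_sqrt; [reflexivity|].
  generalize (pow2_ge_0 (p 0%nat)) (pow2_ge_0 (p 1%nat)) (pow2_ge_0 (p 2%nat)); lra.
Qed.

Lemma upd_same (p : nat -> R) (k : nat) (t : R) : upd p k t k = t.
Proof. unfold upd; now rewrite Nat.eqb_refl. Qed.

Lemma sq3_upd (p : nat -> R) (k : nat) (t : R) :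
  (k < 3)%nat -> sq3 (upd p k t) = sq3 p - p k ^ 2 + t ^ 2.
Proof.
  intro hk; destruct k as [|[|[|k]]]; [| | |lia]; unfold sq3, upd; simpl; ring.
Qed.

Lemma norm3_upd (p : nat -> R) (k : nat) (t : R) :
  (k < 3)%nat -> norm3 (upd p k t) = sqrt (sq3 p - p k ^ 2 + t ^ 2).
Proof. intro hk; rewrite <- (sq3_upd p k t hk); reflexivity. Qed.

Lemma locally_sq3_upd (p : nat -> R) (k : nat) :
  (k < 3)%nat -> 0 < sq3 p -> locally (p k) (fun t => 0 < sq3 (upd p k t)).
Proof.
  intros hk hp.
  apply (filter_imp (fun t => 0 < sq3 p - p k ^ 2 + t ^ 2)).
  { intros t ht; now rewrite sq3_upd. }
  assert (hc : continuous (fun t => sq3 p - p k ^ 2 + t ^ 2) (p k)).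
  { apply (ex_derive_continuous (V := R_NormedModule)); auto_derive; trivial. }
  apply (hc (fun z => 0 < z)).
  apply (open_gt 0); lra.
Qed.

Section Schwarzschild.

Variable m : R.
Hypothesis hm : 0 < m.

Lemma phi_pos (p : nat -> R) : 0 < sq3 p -> 0 < phi m p.
Proof.
  intro hp; generalize (norm3_pos p hp); intro hn; unfold phi.
  assert (0 < m / (2 * norm3 p)) by (apply Rdiv_lt_0_compat; lra); lra.
Qed.

Lemma is_derive_norm3_upd (p : nat -> R) (i : nat) :
  (i < 3)%nat -> 0 < sq3 p ->
  is_derive (fun t => norm3 (upd p i t)) (p i) (p i / norm3 p).
Proof.
  intros hi hp.
  apply (is_derive_ext (fun t => sqrt (sq3 p - p i ^ 2 + t ^ 2))).
  { intro t; now rewrite norm3_upd. }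
  auto_derive; [lra|].
  replace (sq3 p - p i * (p i * 1) + p i * (p i * 1)) with (sq3 p) by ring.
  change (sqrt (sq3 p)) with (norm3 p).
  generalize (norm3_pos p hp); intro; field; lra.
Qed.

Lemma upd_self_norm3 (p : nat -> R) (i : nat) :
  (i < 3)%nat -> norm3 (upd p i (p i)) = norm3 p.
Proof. intro hi; rewrite norm3_upd by trivial; unfold norm3; f_equal; unfold sq3; ring. Qed.

Lemma is_derive_comp_norm3 (f : R -> R) (df : R) (p : nat -> R) (i : nat) :
  (i < 3)%nat -> 0 < sq3 p -> is_derive f (norm3 p) df ->
  is_derive (fun t => f (norm3 (upd p i t))) (p i) (p i / norm3 p * df).
Proof.
  intros hi hp hf.
  apply (is_derive_comp f (fun t => norm3 (upd p i t))).
  - now rewrite upd_self_norm3.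
  - now apply is_derive_norm3_upd.
Qed.

Lemma dpart_gmet (p : nat -> R) (i j l : nat) :
  (i < 3)%nat -> 0 < sq3 p ->
  dpart i (gmet m j l) p = delta j l * (4 * phi m p ^ 4 * dlogphi m i p).
Proof.
  intros hi hp; unfold dpart, gmet, delta.
  destruct (Nat.eqb j l); [|rewrite Derive_const; ring].
  apply is_derive_unique; unfold phi.
  generalize (norm3_pos p hp); intro hn.
  evar_last.
  { apply (is_derive_comp_norm3 (fun n => (1 + m / (2 * n)) ^ 4)); trivial.
    auto_derive; [lra|reflexivity]. }
  unfold dlogphi; field; lra.
Qed.

(** These are the Christoffel symbols of a conformally flat metric [e^(2 f) delta] with
    [f = 2 ln phi]; the 27 index triples are checked one by one. *)
Lemma Gam_eq (p : nat -> R) (k i j : nat) :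
  (k < 3)%nat -> (i < 3)%nat -> (j < 3)%nat -> 0 < sq3 p ->
  Gam m k i j p = 2 * (delta k j * dlogphi m i p + delta k i * dlogphi m j p
                       - delta i j * dlogphi m k p).
Proof.
  intros hk hi hj hp; unfold Gam, sum3.
  rewrite !dpart_gmet by (trivial; lia).
  generalize (phi_pos p hp); intro hphi; unfold ginv.
  destruct k as [|[|[|k]]]; [| | |lia];
  (destruct i as [|[|[|i]]]; [| | |lia];
   (destruct j as [|[|[|j]]]; [| | |lia]; unfold delta; simpl; field; lra)).
Qed.

Lemma dpart_dlogphi (p : nat -> R) (i : nat) :
  (i < 3)%nat -> 0 < sq3 p ->
  dpart i (dlogphi m i) p =
  - m / (norm3 p ^ 2 * (2 * norm3 p + m))
  + m * p i ^ 2 * (6 * norm3 p + 2 * m) / (norm3 p ^ 2 * (2 * norm3 p + m)) ^ 2.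
Proof.
  intros hi hp; unfold dpart, dlogphi.
  generalize (norm3_pos p hp); intro hn.
  apply is_derive_unique.
  (* The explicit coordinate is separated from the dependence through the norm, so that the product
     rule and the radial chain rule apply. *)
  apply (is_derive_ext (fun t => t * (- m / (norm3 (upd p i t) ^ 2 * (2 * norm3 (upd p i t) + m))))).
  { intro t; rewrite upd_same; unfold Rdiv; eqR; ring. }
  assert (hf : is_derive (fun n => - m / (n ^ 2 * (2 * n + m))) (norm3 p)
    (m * (6 * norm3 p ^ 2 + 2 * m * norm3 p) / (norm3 p ^ 2 * (2 * norm3 p + m)) ^ 2)).
  { auto_derive; [|field; lra].
    apply Rgt_not_eq; repeat apply Rmult_lt_0_compat; lra. }
  evar_last.
  { apply (is_derive_mult (fun t => t) _ _ _ _ (is_derive_id _)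
      (is_derive_comp_norm3 _ _ p i hi hp hf)).
    intros; apply Rmult_comm. }
  unfold one, plus, mult; simpl; eqR; rewrite upd_self_norm3 by trivial.
  field; lra.
Qed.

(** The complement of the origin is open, so formulas valid there may be differentiated. *)
Lemma dpart_ext_loc (k : nat) (F G : (nat -> R) -> R) (p : nat -> R) :
  (k < 3)%nat -> 0 < sq3 p -> (forall q, 0 < sq3 q -> F q = G q) ->
  dpart k F p = dpart k G p.
Proof.
  intros hk hp h; unfold dpart; apply Derive_ext_loc.
  generalize (locally_sq3_upd p k hk hp); apply filter_imp; intros t; apply h.
Qed.

Lemma dpart_scal (k : nat) (c : R) (F : (nat -> R) -> R) (p : nat -> R) :
  dpart k (fun q => c * F q) p = c * dpart k F p.
Proof. unfold dpart; apply Derive_scal. Qed.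

(** Each symbol differentiated in [Ric m 2 2] is a multiple of the component of [d ln phi] in the
    direction of differentiation, so only unmixed second derivatives of [ln phi] occur. *)
Lemma dpart_Gam (p : nat -> R) (l i k j : nat) (c : R) :
  (l < 3)%nat -> (k < 3)%nat -> (i < 3)%nat -> (j < 3)%nat -> 0 < sq3 p ->
  (forall q, 2 * (delta k j * dlogphi m i q + delta k i * dlogphi m j q
                       - delta i j * dlogphi m k q) = c * dlogphi m l q) ->
  dpart l (Gam m k i j) p = c * dpart l (dlogphi m l) p.
Proof.
  intros hl hk hi hj hp h.
  rewrite <- dpart_scal; apply dpart_ext_loc; trivial.
  intros q hq; rewrite Gam_eq; trivial.
Qed.

(** With the area radius [rho = r phi^2] the value is [phi^4 m / rho^3], the Ricci curvature in a
    direction tangent to the centred spheres. *)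
Lemma Ric22_eq (x y : R) : 0 < x ^ 2 + y ^ 2 ->
  Ric m 2 2 (pt x y) = 4 * m / (norm3 (pt x y) * (2 * norm3 (pt x y) + m) ^ 2).
Proof.
  intro hxy.
  assert (hp : 0 < sq3 (pt x y)) by (unfold sq3, pt; simpl in *; lra).
  unfold Ric, sum3.
  rewrite (dpart_Gam _ 0 2 0 2 (-2)), (dpart_Gam _ 1 2 1 2 (-2)), (dpart_Gam _ 2 2 2 2 2),
    (dpart_Gam _ 2 2 0 0 2), (dpart_Gam _ 2 2 1 1 2)
    by (try lia; trivial; intro q; unfold delta; simpl; ring).
  rewrite !Gam_eq by (trivial; lia).
  rewrite !dpart_dlogphi by (trivial; lia).
  unfold delta; simpl Nat.eqb; cbv iota.
  generalize (norm3_pos _ hp) (norm3_sqr (pt x y)).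
  unfold dlogphi; unfold sq3; simpl pt.
  set (n := norm3 (pt x y)); intros hn hn2.
  (* [y] is eliminated through [n^2 = x^2 + y^2], which leaves a rational identity in [x], [n] and
     [m]. *)
  replace (y ^ 2) with (n ^ 2 - x ^ 2) by (rewrite hn2; simpl; ring).
  field_simplify_eq; [|lra].
  replace (y ^ 2) with (n ^ 2 - x ^ 2) by (rewrite hn2; simpl; ring).
  ring.
Qed.

Lemma dpart_const (k : nat) (c : R) (p : nat -> R) : dpart k (fun _ => c) p = 0.
Proof. exact (Derive_const c (p k)). Qed.

(** For tangential [i], [k] the symbol [Gam m k i 2] is a multiple of the normal derivative of
    [ln phi], which vanishes on the plane by reflection symmetry. *)
Lemma nabla_Nfield_tangential (V p : nat -> R) (k : nat) :
  (k < 2)%nat -> 0 < sq3 p -> p 2%nat = 0 -> V 2%nat = 0 -> nabla m V (Nfield m) p k = 0.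
Proof.
  intros hk hp h2 hV.
  unfold nabla, sum3, Nfield.
  replace (Nat.eqb k 2) with false by (destruct k as [|[|k]]; [reflexivity|reflexivity|lia]).
  simpl Nat.eqb; cbv iota.
  rewrite !dpart_const, hV, !(Gam_eq p k _ 2) by (trivial; lia).
  unfold dlogphi; rewrite h2.
  destruct k as [|[|k]]; [| |lia]; unfold delta, Rdiv; simpl; ring.
Qed.

Lemma normA2_eq0 (x y : R) : 0 < x ^ 2 + y ^ 2 -> normA2 m (pt x y) = 0.
Proof.
  intro hxy.
  assert (hp : 0 < sq3 (pt x y)) by (unfold sq3, pt; simpl in *; lra).
  assert (h : forall a b, (a < 2)%nat -> (b < 2)%nat ->
    ASigma m (pt x y) (Eframe m (pt x y) a) (Eframe m (pt x y) b) = 0).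
  { intros a b ha hb; unfold ASigma, gval, sum3, gmet.
    assert (hE : Eframe m (pt x y) a 2%nat = 0)
      by (unfold Eframe; destruct a as [|[|a]]; [reflexivity|reflexivity|lia]).
    rewrite (nabla_Nfield_tangential _ _ 0), (nabla_Nfield_tangential _ _ 1)
      by (trivial; lia).
    unfold Eframe; destruct b as [|[|b]]; [| |lia]; simpl; ring. }
  unfold normA2; rewrite !h by lia; ring.
Qed.

Lemma RicNN_eq (x y : R) : 0 < x ^ 2 + y ^ 2 ->
  RicVW m (pt x y) (Nfield m (pt x y)) (Nfield m (pt x y)) * phi m (pt x y) ^ 4
  = 4 * m / (norm3 (pt x y) * (2 * norm3 (pt x y) + m) ^ 2).
Proof.
  intro hxy.
  assert (hp : 0 < sq3 (pt x y)) by (unfold sq3, pt; simpl in *; lra).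
  rewrite <- Ric22_eq by trivial.
  unfold RicVW, sum3, Nfield; simpl Nat.eqb; cbv iota.
  generalize (phi_pos _ hp); intro; field; lra.
Qed.

(** The Dirichlet energy is conformally invariant in dimension two, so [phi] survives only in the
    potential. *)
Lemma Qdens_eq (u : R -> R -> R) (x y r : R) : 0 < r -> x ^ 2 + y ^ 2 = r ^ 2 ->
  Qdens m u x y
  = d1 u x y ^ 2 + d2 u x y ^ 2 - 4 * m / (r * (2 * r + m) ^ 2) * u x y ^ 2.
Proof.
  intros hr hxy.
  assert (h : 0 < x ^ 2 + y ^ 2) by (rewrite hxy; apply pow_lt, hr).
  assert (hp : 0 < sq3 (pt x y)) by (unfold sq3, pt; simpl in *; lra).
  replace r with (norm3 (pt x y)).
  2:{ unfold norm3, pt. replace (_ + _) with (r ^ 2) by (rewrite <- hxy; simpl; ring).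
      apply sqrt_pow2; lra. }
  rewrite <- RicNN_eq by trivial.
  unfold Qdens; cbv zeta; rewrite normA2_eq0 by trivial.
  generalize (phi_pos _ hp); intro; field; lra.
Qed.

Lemma AdM_NN_eq0 (x y : R) : x ^ 2 + y ^ 2 = (m / 2) ^ 2 -> AdM_NN m (pt x y) = 0.
Proof.
  intros hxy.
  assert (h : 0 < x ^ 2 + y ^ 2) by (rewrite hxy; apply pow_lt; lra).
  assert (hp : 0 < sq3 (pt x y)) by (unfold sq3, pt; simpl in *; lra).
  assert (hn : norm3 (pt x y) = m / 2).
  { unfold norm3, pt. replace (_ + _) with ((m / 2) ^ 2) by (rewrite <- hxy; simpl; ring).
    apply sqrt_pow2; lra. }
  assert (hphi : phi m (pt x y) = 2) by (unfold phi; rewrite hn; field; lra).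
  assert (hd : dpart 2 (fun q => eta m q 2%nat) (pt x y) = - / (2 * m)).
  { unfold dpart, eta, phi.
    apply is_derive_unique.
    apply (is_derive_ext (fun t => t * (- / (norm3 (upd (pt x y) 2 t)
       * (1 + m / (2 * norm3 (upd (pt x y) 2 t))) ^ 2)))).
    { intro t; rewrite upd_same; unfold Rdiv; eqR; ring. }
    (* The factor [t] is zero on the plane, so the derivative of this radial factor enters
       multiplied by zero; its existence suffices. *)
    assert (hf : ex_derive (fun n => - / (n * (1 + m / (2 * n)) ^ 2)) (norm3 (pt x y))).
    { rewrite hn; auto_derive. split; [lra|]; split; trivial.
      replace (m * / (2 * (m / 2))) with 1 by (field; lra). lra. }
    destruct hf as [df hf].
    evar_last.
    { apply (is_derive_mult (fun t => t) _ _ _ _ (is_derive_id _)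
        (is_derive_comp_norm3 _ _ (pt x y) 2 ltac:(lia) hp hf)).
      intros; apply Rmult_comm. }
    unfold one, plus, mult; simpl; eqR; rewrite upd_self_norm3, hn by lia.
    field; lra. }
  unfold AdM_NN, gval, sum3, gmet, nabla, sum3, Nfield; simpl Nat.eqb; cbv iota.
  rewrite hd, !(Gam_eq _ 2 2) by (trivial; lia).
  unfold delta; simpl Nat.eqb; cbv iota; unfold dlogphi, eta; rewrite hphi, hn; simpl pt.
  (* The derivative of [eta] contributes [-1/(2m)] and the Christoffel symbols [2 (x^2 + y^2)/m^3];
     they cancel exactly on the horizon. *)
  match goal with |- ?L = 0 => replace L with ((x ^ 2 + y ^ 2 - (m/2)^2) * (- / (2 * m ^ 3) * 4)) end.
  rewrite hxy; ring.
  field; lra.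
Qed.

End Schwarzschild.

(** * One-variable integral inequalities *)

Lemma ex_RInt_continuous_above (f : R -> R) (lo a b : R) :
  lo < a -> lo < b -> (forall x, lo < x -> continuous f x) -> ex_RInt f a b.
Proof.
  intros ha hb hf; apply (ex_RInt_continuous (V := R_CompleteNormedModule)).
  intros z [hz _]; apply hf.
  apply Rlt_le_trans with (2 := hz); now apply Rmin_glb_lt.
Qed.

Lemma is_derive_RInt_above (f : R -> R) (lo a x : R) :
  lo < a -> lo < x -> (forall y, lo < y -> continuous f y) ->
  is_derive (fun t => RInt f a t) x (f x).
Proof.
  intros ha hx hf.
  apply (is_derive_RInt (V := R_NormedModule) f _ a x); [|now apply hf].
  generalize (open_gt lo x hx); apply filter_imp; intros y hy.
  apply (RInt_correct (V := R_CompleteNormedModule)).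
  now apply (ex_RInt_continuous_above f lo).
Qed.

(** Calibration principle: the primitive of [f] minus [D] is nondecreasing. Every integral estimate
    below subtracts squares from [f] or from a bound until an explicit [D] integrates the rest. *)
Lemma RInt_ge_of_derive_le (f D dD : R -> R) (lo a b : R) :
  lo < a -> a <= b ->
  (forall x, lo < x -> continuous f x) ->
  (forall x, a <= x <= b -> is_derive D x (dD x)) ->
  (forall x, a <= x <= b -> dD x <= f x) ->
  D b - D a <= RInt f a b.
Proof.
  intros ha hab hf hD hle.
  assert (hG : forall x, a <= x <= b -> is_derive (fun t => RInt f a t - D t) x (f x - dD x)).
  { intros x hx; apply (is_derive_minus (fun t => RInt f a t)).
    - apply (is_derive_RInt_above f lo); trivial; lra.
    - now apply hD. }
  destruct (MVT_gen (fun t => RInt f a t - D t) a b (fun x => f x - dD x)) as [c [hc e]].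
  - intros x hx; apply hG; rewrite Rmin_left, Rmax_right in hx; lra.
  - intros x hx; rewrite Rmin_left, Rmax_right in hx by lra.
    apply continuity_pt_filterlim.
    apply (ex_derive_continuous (V := R_NormedModule) (fun t => RInt f a t - D t)).
    eexists; now apply hG.
  - rewrite Rmin_left, Rmax_right in hc by lra.
    rewrite (RInt_point a f) in e; unfold zero in e; simpl in e.
    specialize (hle c hc).
    assert (0 <= (f c - dD c) * (b - a)) by (apply Rmult_le_pos; lra).
    lra.
Qed.

Lemma continuous_RInt_param (f : R -> R -> R) (a b x : R) :
  a <= b ->
  (forall y t, a <= t <= b -> continuity_2d_pt f y t) ->
  continuous (fun y => RInt (f y) a b) x.
Proof.
  intros hab hf.
  assert (hi : forall y, ex_RInt (f y) a b).
  { intro y; apply (ex_RInt_continuous (V := R_CompleteNormedModule)).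
    rewrite Rmin_left, Rmax_right by trivial; intros t ht.
    apply continuity_pt_filterlim.
    intros eps heps; destruct (hf y t ht (mkposreal eps heps)) as [d hd].
    exists d; split; [apply cond_pos|].
    intros z [_ hz]; apply hd; [rewrite Rminus_diag, Rabs_R0; apply cond_pos|exact hz]. }
  apply filterlim_locally; intros eps.
  (* The summand 1 keeps the denominator positive when [a = b]; multiplied by the length [b - a] the
     quotient stays below [eps]. *)
  assert (he : 0 < eps / (2 * (b - a + 1)))
    by (apply Rdiv_lt_0_compat; [apply cond_pos|lra]).
  destruct (uniform_continuity_2d_1d' f a b x (fun t ht => hf x t ht)
              (mkposreal _ he)) as [d hd].
  exists d; intros y hy.
  change (Rabs (RInt (f y) a b - RInt (f x) a b) < eps).
  rewrite <- (RInt_minus (V := R_CompleteNormedModule)) by trivial.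
  apply Rle_lt_trans with ((b - a) * (eps / (2 * (b - a + 1)))).
  - apply abs_RInt_le_const; trivial.
    + apply (ex_RInt_minus (V := R_NormedModule)); trivial.
    + intros t ht; apply Rlt_le.
      change (Rabs (y - x) < d) in hy; apply Rabs_lt_between' in hy.
      apply hd; trivial; try lra.
      rewrite Rminus_diag, Rabs_R0; apply cond_pos.
  - apply Rlt_le_trans with (eps * 1); [|lra].
    replace ((b - a) * (eps / (2 * (b - a + 1)))) with (eps * ((b - a) / (2 * (b - a + 1))))
      by (field; lra).
    apply Rmult_lt_compat_l; [apply cond_pos|].
    apply Rmult_lt_reg_r with (2 * (b - a + 1)); [lra|].
    unfold Rdiv; rewrite Rmult_assoc, Rinv_l by lra; lra.
Qed.

(* The primitive [A] of [a] vanishes at both ends.  The derivative of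
   [- 2 b^2 a A - b^3 tan (b (x - PI)) A^2] differs from [a'^2 - b^2 a^2] by the two squares
   [(a' + b^2 A)^2] and [b^2 (a + b tan (b (x - PI)) A)^2]. *)
Lemma poincare_mean_zero (a da : R -> R) (b : R) :
  0 <= b < / 2 ->
  (forall x, is_derive a x (da x)) -> (forall x, continuous da x) ->
  RInt a 0 (2 * PI) = 0 ->
  0 <= RInt (fun x => da x ^ 2 - b ^ 2 * a x ^ 2) 0 (2 * PI).
Proof.
  intros hb ha hda hmean.
  assert (hac : forall x, continuous a x)
    by (intro x; apply (ex_derive_continuous (V := R_NormedModule)); eexists; apply ha).
  set (A := fun x => RInt a 0 x).
  assert (hA : forall x, is_derive A x (a x)).
  { intro x; apply (is_derive_RInt_above a (Rmin 0 x - 1)); trivial.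
    - generalize (Rmin_l 0 x); lra.
    - generalize (Rmin_r 0 x); lra. }
  assert (hA0 : A 0 = 0) by apply (RInt_point 0 a).
  assert (hA1 : A (2 * PI) = 0) by exact hmean.
  set (t := fun x => sin (b * (x - PI)) / cos (b * (x - PI))).
  set (D := fun x => - 2 * b ^ 2 * (a x * A x) - b ^ 3 * t x * A x ^ 2).
  replace 0 with (D (2 * PI) - D 0) at 1
    by (unfold D; rewrite hA0, hA1; ring).
  generalize PI_RGT_0; intro hpi.
  apply (RInt_ge_of_derive_le _ _
    (fun x => da x ^ 2 - b ^ 2 * a x ^ 2
      - (da x + b ^ 2 * A x) ^ 2 - b ^ 2 * (a x + b * t x * A x) ^ 2) (-1)); try lra.
  - intros x _.
    apply (continuous_minus (V := R_NormedModule)).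
    + apply (continuous_comp da (fun z => z ^ 2)); trivial.
      apply (ex_derive_continuous (V := R_NormedModule)); auto_derive; trivial.
    + apply (continuous_comp a (fun z => b ^ 2 * z ^ 2)); trivial.
      apply (ex_derive_continuous (V := R_NormedModule)); auto_derive; trivial.
  - intros x hx.
    (* This is where [b < 1/2] enters: the argument stays within [(-PI/2, PI/2)], so the tangent in
       [D] is finite on the whole interval. *)
    assert (hc : 0 < cos (b * (x - PI))).
    { assert (b * PI < / 2 * PI) by (apply Rmult_lt_compat_r; lra).
      assert (b * (x - PI) <= b * PI) by (apply Rmult_le_compat_l; lra).
      assert (b * (PI - x) <= b * PI) by (apply Rmult_le_compat_l; lra).
      apply cos_gt_0; lra. }
    unfold D, t; auto_derive.
    + assert (ea : ex_derive a x) by (eexists; apply ha).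
      assert (eA : ex_derive A x) by (eexists; apply hA).
      unfold Rminus in hc; repeat split; trivial; lra.
    + change (Derive (fun x => a x) x) with (Derive a x).
      change (Derive (fun x => A x) x) with (Derive A x).
      rewrite (is_derive_unique _ _ _ (ha x)), (is_derive_unique _ _ _ (hA x)).
      generalize (sin2_cos2 (b * (x - PI))); unfold Rsqr.
      unfold Rminus in *; set (s := sin _) in *; set (c := cos _) in *; intro hsc.
      field_simplify_eq; [|lra].
      replace (s ^ 2) with (1 - c ^ 2) by (simpl; lra).
      ring.
  - intros x _.
    generalize (pow2_ge_0 (da x + b ^ 2 * A x)) (pow2_ge_0 (b * (a x + b * t x * A x))).
    rewrite (Rpow_mult_distr b); lra.
Qed.

(** * The radial inequality *)

(* With [r = k e^(2s)], [wt k r dr = sech s ds]. *)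
Definition wt (k r : R) : R := / (sqrt (r / k) * (r + k)).

Lemma is_derive_sqrt_div (k r : R) : 0 < k -> 0 < r ->
  is_derive (fun t => sqrt (t / k)) r (/ (2 * k * sqrt (r / k))).
Proof.
  intros hk hr.
  assert (h : 0 < r / k) by now apply Rdiv_lt_0_compat.
  assert (hs := sqrt_lt_R0 _ h).
  auto_derive; [exact h|].
  change (r * / k) with (r / k); field; lra.
Qed.

Lemma continuous_wt (k r : R) : 0 < k -> 0 < r -> continuous (wt k) r.
Proof.
  intros hk hr.
  assert (h : 0 < r / k) by now apply Rdiv_lt_0_compat.
  assert (hs := sqrt_lt_R0 _ h).
  apply (ex_derive_continuous (V := R_NormedModule)).
  unfold wt; auto_derive; repeat split; trivial.
  change (r * / k) with (r / k).
  apply Rgt_not_eq, Rmult_lt_0_compat; lra.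
Qed.

(* With [t = k e^(2s)] and [q = e^s], the values [T], [ch], [sh] are [tanh s], [cosh s], [sinh s].
   For [B' = u wt], the [s]-derivative of the parenthesis is
   [u_s^2 - 2 sech^2 u^2 - (u_s + T u + B ch - c sh)^2 - (u + B sh - c ch)^2];
   the last two terms of [calib] implement Cauchy-Schwarz for the angular derivative. *)
Definition calib (k c e : R) (u q B E : R -> R) (t : R) : R :=
  let T := (t - k) / (t + k) in
  let ch := (q t + / q t) / 2 in
  let sh := (q t - / q t) / 2 in
  / 2 * (- T * u t ^ 2 - 2 * u t * B t * ch - B t ^ 2 * sh * ch + 2 * c * sh * u t
         + 2 * c * B t * sh ^ 2 - c ^ 2 * sh * ch)
  + 4 * e * E t - 2 * e ^ 2 * T.

(** The first line is the energy density with respect to [dr], where [ds = dr/(2r)]; the squares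
    subtracted from it have positive weights for [r > 0]. *)
Definition dcalib (k c e : R) (u q B : R -> R) (ur ut r : R) : R :=
  let T := (r - k) / (r + k) in
  let ch := (q r + / q r) / 2 in
  let sh := (q r - / q r) / 2 in
  r * ur ^ 2 + ut ^ 2 / r - 2 * k / (r + k) ^ 2 * u r ^ 2
  - ((2 * r * ur + T * u r + B r * ch - c * sh) ^ 2
     + (u r + B r * sh - c * ch) ^ 2) / (4 * r)
  - (ut - 2 * e * r * / (q r * (r + k))) ^ 2 / r.

Lemma is_derive_calibration (k c e r : R) (u q B E : R -> R) (ur ut : R) :
  0 < k -> 0 < r -> 0 < q r -> r = k * q r ^ 2 ->
  is_derive q r (/ (2 * k * q r)) ->
  is_derive u r ur ->
  is_derive B r (u r * / (q r * (r + k))) ->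
  is_derive E r (ut * / (q r * (r + k))) ->
  is_derive (calib k c e u q B E) r (dcalib k c e u q B ur ut r).
Proof.
  intros hk hr hq hrq dq du dB dE; unfold calib, dcalib; cbv zeta.
  auto_derive.
  - assert (eq : ex_derive q r) by (eexists; apply dq).
    assert (eu : ex_derive u r) by (eexists; apply du).
    assert (eB : ex_derive B r) by (eexists; apply dB).
    assert (eE : ex_derive E r) by (eexists; apply dE).
    repeat split; trivial; lra.
  - change (Derive (fun x => q x) r) with (Derive q r).
    change (Derive (fun x => u x) r) with (Derive u r).
    change (Derive (fun x => B x) r) with (Derive B r).
    change (Derive (fun x => E x) r) with (Derive E r).
    rewrite (is_derive_unique _ _ _ dq), (is_derive_unique _ _ _ du),
      (is_derive_unique _ _ _ dB), (is_derive_unique _ _ _ dE).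
    set (qr := q r) in *; clearbody qr.
    generalize (u r) (B r) (E r); intros v b f.
    (* Substituting [r = k q^2] removes the square root and makes both sides rational. *)
    clear dq du dB dE; subst r; field.
    assert (0 < qr ^ 2) by (apply pow_lt, hq); repeat split; nra.
Qed.

(** The calibration is used with [c], [e] the final values of [B], [E]. It vanishes at [r = k],
    where [T], [sh], [B], [E] are zero; at [Rd], where [u = 0], its radial part is
    [- c^2 sh (ch - sh)], that is [- (1/2) (1 - k/Rd) c^2]. *)
Lemma radial_lower_bound (k Rd : R) (u ur ut : R -> R) :
  0 < k -> k <= Rd ->
  (forall r, 0 < r -> is_derive u r (ur r)) ->
  (forall r, 0 < r -> continuous ur r) ->
  (forall r, 0 < r -> continuous ut r) ->
  u Rd = 0 ->
  2 * RInt (fun r => ut r * wt k r) k Rd ^ 2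
  - / 2 * (1 - k / Rd) * RInt (fun r => u r * wt k r) k Rd ^ 2
  <= RInt (fun r => r * ur r ^ 2 + ut r ^ 2 / r - 2 * k / (r + k) ^ 2 * u r ^ 2) k Rd.
Proof.
  intros hk hR du cur cut uR.
  assert (cu : forall r, 0 < r -> continuous u r)
    by (intros r hr; apply (ex_derive_continuous (V := R_NormedModule)); eexists; now apply du).
  set (e := RInt (fun r => ut r * wt k r) k Rd).
  set (c := RInt (fun r => u r * wt k r) k Rd).
  set (B := fun t : R => RInt (fun r => u r * wt k r) k t).
  set (E := fun t => RInt (fun r => ut r * wt k r) k t).
  set (q := fun t => sqrt (t / k)).
  assert (dB : forall r, 0 < r -> is_derive B r (u r * wt k r)).
  { intros r hr; apply (is_derive_RInt_above (fun r => u r * wt k r) 0); trivial.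
    intros y hy; apply (continuous_mult (K := R_AbsRing)); [now apply cu|now apply continuous_wt]. }
  assert (dE : forall r, 0 < r -> is_derive E r (ut r * wt k r)).
  { intros r hr; apply (is_derive_RInt_above (fun r => ut r * wt k r) 0); trivial.
    intros y hy; apply (continuous_mult (K := R_AbsRing)); [now apply cut|now apply continuous_wt]. }
  assert (hq : forall r, 0 < r -> 0 < q r)
    by (intros r hr; apply sqrt_lt_R0; now apply Rdiv_lt_0_compat).
  assert (hq2 : forall r, 0 < r -> r = k * q r ^ 2).
  { intros r hr; unfold q; rewrite pow2_sqrt; [field; lra|].
    apply Rlt_le; now apply Rdiv_lt_0_compat. }
  eapply Rle_trans.
  2:{ apply (RInt_ge_of_derive_le _ (calib k c e u q B E)
        (fun r => dcalib k c e u q B (ur r) (ut r) r) 0 k Rd hk hR).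
      2:{ intros r hr; apply is_derive_calibration; trivial; try lra.
          - apply hq; lra.
          - apply hq2; lra.
          - apply is_derive_sqrt_div; lra.
          - apply du; lra.
          - apply dB; lra.
          - apply dE; lra. }
      - intros r hr.
        apply (continuous_minus (V := R_NormedModule)).
        + apply (continuous_plus (V := R_NormedModule)).
          * apply (continuous_mult (K := R_AbsRing)); [apply continuous_id|].
            apply (continuous_comp ur (fun z => z ^ 2)); [now apply cur|].
            apply (ex_derive_continuous (V := R_NormedModule)); auto_derive; trivial.
          * apply (continuous_mult (K := R_AbsRing)).
            -- apply (continuous_comp ut (fun z => z ^ 2)); [now apply cut|].
               apply (ex_derive_continuous (V := R_NormedModule)); auto_derive; trivial.
            -- apply (ex_derive_continuous (V := R_NormedModule)); auto_derive; lra.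
        + apply (continuous_mult (K := R_AbsRing)).
          * apply (ex_derive_continuous (V := R_NormedModule)); auto_derive.
            apply Rgt_not_eq, Rmult_lt_0_compat; lra.
          * apply (continuous_comp u (fun z => z ^ 2)); [now apply cu|].
            apply (ex_derive_continuous (V := R_NormedModule)); auto_derive; trivial.
      - intros r hr; unfold dcalib; cbv zeta.
        match goal with |- _ - ?X / _ - ?Y / _ <= _ =>
          assert (0 <= X / (4 * r)); [|assert (0 <= Y / r); [|lra]] end.
        + apply Rdiv_le_0_compat; [|lra].
          apply Rplus_le_le_0_compat; apply pow2_ge_0.
        + apply Rdiv_le_0_compat; [apply pow2_ge_0|lra]. }
  unfold calib; cbv zeta.
  assert (hB0 : B k = 0) by apply (RInt_point k (fun r => u r * wt k r)).
  assert (hE0 : E k = 0) by apply (RInt_point k (fun r => ut r * wt k r)).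
  assert (hq0 : q k = 1) by (unfold q; replace (k / k) with 1 by (field; lra); apply sqrt_1).
  change (B Rd) with c; change (E Rd) with e.
  rewrite uR, hB0, hE0, hq0.
  assert (hRd : 0 < Rd) by lra.
  assert (hQ := hq Rd hRd); assert (hQ2 := hq2 Rd hRd).
  set (Q := q Rd) in *; clearbody Q c e.
  (* The angular part at [Rd] is [4 e^2 - 2 e^2 T] with [T = 1 - 2k/(Rd + k)], which exceeds [2 e^2]
     by the added term. *)
  match goal with |- ?X <= ?Y => replace (Y) with (X + 2 * e ^ 2 * (2 * k / (Rd + k))) end.
  - assert (0 <= e ^ 2 * (2 * k / (Rd + k))); [|lra].
    apply Rmult_le_pos; [apply pow2_ge_0|apply Rdiv_le_0_compat; lra].
  - clear - hk hQ hQ2; subst Rd; field.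
    assert (0 < Q ^ 2) by (apply pow_lt, hQ); repeat split; nra.
Qed.

(** * Polar coordinates and the upper bound on the index *)

Definition cont2 (f : R -> R -> R) (x y : R) : Prop :=
  continuous (fun z : R * R => f (fst z) (snd z)) (x, y).

(** The part of [smooth2] that the upper bound uses, in a form that passes directly to linear
    combinations. *)
Definition C1 (u : R -> R -> R) : Prop :=
  (forall x y, ex_derive (fun t => u t y) x /\ ex_derive (fun t => u x t) y) /\
  (forall x y, cont2 u x y) /\ (forall x y, cont2 (d1 u) x y) /\ (forall x y, cont2 (d2 u) x y).

Lemma smooth2_C1 (u : R -> R -> R) : smooth2 u -> C1 u.
Proof.
  intros [S [hu hS]].
  destruct (hS u hu) as [c [e [h1 h2]]].
  split; [exact e|]; split; [exact c|].
  split; [apply (hS _ h1)|apply (hS _ h2)].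
Qed.

Lemma cont2_continuity_2d_pt (f : R -> R -> R) (x y : R) : cont2 f x y -> continuity_2d_pt f x y.
Proof. intro h; apply continuity_2d_pt_filterlim, h. Qed.

Lemma cont2_section (f : R -> R -> R) (x y : R) : cont2 f x y -> continuous (f x) y.
Proof.
  intro h; apply (continuous_comp_2 (fun _ : R => x) (fun t : R => t) f y);
    [apply continuous_const|apply continuous_id|exact h].
Qed.

Lemma cont2_mult (f g : R -> R -> R) (x y : R) :
  cont2 f x y -> cont2 g x y -> cont2 (fun a b => f a b * g a b) x y.
Proof. intros hf hg; exact (continuous_mult (K := R_AbsRing) _ _ _ hf hg). Qed.

Lemma cont2_plus (f g : R -> R -> R) (x y : R) :
  cont2 f x y -> cont2 g x y -> cont2 (fun a b => f a b + g a b) x y.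
Proof. intros hf hg; exact (continuous_plus (V := R_NormedModule) _ _ _ hf hg). Qed.

Lemma cont2_minus (f g : R -> R -> R) (x y : R) :
  cont2 f x y -> cont2 g x y -> cont2 (fun a b => f a b - g a b) x y.
Proof. intros hf hg; exact (continuous_minus (V := R_NormedModule) _ _ _ hf hg). Qed.

Lemma cont2_fst (f : R -> R) (x y : R) : continuous f x -> cont2 (fun a _ => f a) x y.
Proof. intro h; apply (continuous_comp (fst : R * R -> R) f); [apply continuous_fst|exact h]. Qed.

Lemma cont2_snd (f : R -> R) (x y : R) : continuous f y -> cont2 (fun _ b => f b) x y.
Proof. intro h; apply (continuous_comp (snd : R * R -> R) f); [apply continuous_snd|exact h]. Qed.

Lemma cont2_sqr (f : R -> R -> R) (x y : R) :
  cont2 f x y -> cont2 (fun a b => f a b ^ 2) x y.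
Proof.
  intro h; apply (continuous_comp _ (fun z : R => z ^ 2)); [exact h|].
  apply (ex_derive_continuous (V := R_NormedModule)); auto_derive; trivial.
Qed.

(** The angle comes first, so that partial application restricts [u] to a ray. *)
Definition polar (u : R -> R -> R) (th r : R) : R := u (r * cos th) (r * sin th).

Lemma cont2_polar (f : R -> R -> R) (th r : R) :
  (forall x y, cont2 f x y) -> cont2 (polar f) th r.
Proof.
  intro h; unfold cont2, polar.
  apply (continuous_comp_2 (fun z : R * R => snd z * cos (fst z))
           (fun z : R * R => snd z * sin (fst z)) f); [| |apply h].
  - apply (cont2_mult (fun _ b => b) (fun a _ => cos a)).
    + apply (cont2_snd (fun b => b)), continuous_id.
    + apply (cont2_fst cos), continuous_cos.
  - apply (cont2_mult (fun _ b => b) (fun a _ => sin a)).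
    + apply (cont2_snd (fun b => b)), continuous_id.
    + apply (cont2_fst sin), continuous_sin.
Qed.

Definition polar_dr (u : R -> R -> R) (th r : R) : R :=
  polar (d1 u) th r * cos th + polar (d2 u) th r * sin th.

Definition polar_dth (u : R -> R -> R) (th r : R) : R :=
  r * (polar (d2 u) th r * cos th - polar (d1 u) th r * sin th).

(** Continuity of one partial derivative and existence of the other give total differentiability, as
    the chain rule in polar coordinates requires. *)
Lemma C1_differentiable (u : R -> R -> R) (x y : R) :
  C1 u -> differentiable_pt_lim u x y (d1 u x y) (d2 u x y).
Proof.
  intros [e [_ [c1 _]]].
  apply filterdiff_differentiable_pt_lim.
  apply (is_derive_filterdiff u x y (d1 u) (d2 u x y)).
  - apply filter_forall; intros [a b]; apply Derive_correct, (e a b).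
  - apply Derive_correct, (e x y).
  - apply c1.
Qed.

Lemma is_derive_polar_r (u : R -> R -> R) (th r : R) :
  C1 u -> is_derive (fun t => polar u th t) r (polar_dr u th r).
Proof.
  intro h; apply is_derive_Reals.
  apply (derivable_pt_lim_comp_2d u (fun t => t * cos th) (fun t => t * sin th)).
  - now apply C1_differentiable.
  - apply is_derive_Reals; auto_derive; trivial; ring.
  - apply is_derive_Reals; auto_derive; trivial; ring.
Qed.

Lemma is_derive_polar_th (u : R -> R -> R) (th r : R) :
  C1 u -> is_derive (fun t => polar u t r) th (polar_dth u th r).
Proof.
  intro h; apply is_derive_Reals.
  replace (polar_dth u th r) with
    (polar (d1 u) th r * (- r * sin th) + polar (d2 u) th r * (r * cos th))
    by (unfold polar_dth; ring).
  apply (derivable_pt_lim_comp_2d u (fun t => r * cos t) (fun t => r * sin t)).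
  - now apply C1_differentiable.
  - apply is_derive_Reals; auto_derive; trivial; ring.
  - apply is_derive_Reals; auto_derive; trivial; ring.
Qed.

Lemma cont2_polar_dr (u : R -> R -> R) (th r : R) : C1 u -> cont2 (polar_dr u) th r.
Proof.
  intros [_ [_ [c1 c2]]]; unfold polar_dr.
  apply cont2_plus; apply cont2_mult; try now apply cont2_polar.
  - apply cont2_fst, continuous_cos.
  - apply cont2_fst, continuous_sin.
Qed.

Lemma cont2_polar_dth (u : R -> R -> R) (th r : R) : C1 u -> cont2 (polar_dth u) th r.
Proof.
  intros [_ [_ [c1 c2]]]; unfold polar_dth.
  apply cont2_mult; [apply (cont2_snd (fun b => b)), continuous_id|].
  apply cont2_minus; apply cont2_mult; try now apply cont2_polar.
  - apply cont2_fst, continuous_cos.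
  - apply cont2_fst, continuous_sin.
Qed.

(** The function [a(th)]: the pairing of [u] along a ray with the radial ground state [sech s]. *)
Definition ray_moment (k Rd : R) (u : R -> R -> R) (th : R) : R :=
  RInt (fun r => polar u th r * wt k r) k Rd.

Definition ray_moment_dth (k Rd : R) (u : R -> R -> R) (th : R) : R :=
  RInt (fun r => polar_dth u th r * wt k r) k Rd.

Lemma continuous_ray_moment_dth (k Rd : R) (u : R -> R -> R) (th : R) :
  0 < k -> k <= Rd -> C1 u -> continuous (ray_moment_dth k Rd u) th.
Proof.
  intros hk hR hu.
  apply (continuous_RInt_param (fun th r => polar_dth u th r * wt k r)); trivial.
  intros y t ht; apply cont2_continuity_2d_pt, cont2_mult.
  - now apply cont2_polar_dth.
  - apply cont2_snd, continuous_wt; lra.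
Qed.

Lemma ex_RInt_ray (k Rd : R) (u : R -> R -> R) (th : R) :
  0 < k -> k <= Rd -> C1 u -> ex_RInt (fun r => polar u th r * wt k r) k Rd.
Proof.
  intros hk hR hu.
  apply (ex_RInt_continuous_above _ 0); try lra; intros r hr.
  apply (continuous_mult (K := R_AbsRing)); [|apply continuous_wt; lra].
  apply (cont2_section (polar u)), cont2_polar, hu.
Qed.

Lemma is_derive_ray_moment (k Rd : R) (u : R -> R -> R) (th : R) :
  0 < k -> k <= Rd -> C1 u ->
  is_derive (ray_moment k Rd u) th (ray_moment_dth k Rd u th).
Proof.
  intros hk hR hu.
  assert (hd : forall z t, is_derive (fun z => polar u z t * wt k t) z (polar_dth u z t * wt k t)).
  { intros z t.
    apply (is_derive_ext (fun z => wt k t * polar u z t)); [intro; apply Rmult_comm|].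
    rewrite Rmult_comm; apply is_derive_scal; now apply is_derive_polar_th. }
  unfold ray_moment_dth.
  rewrite <- (RInt_ext (fun t => Derive (fun z => polar u z t * wt k t) th)).
  2:{ intros t _; apply is_derive_unique, hd. }
  apply (is_derive_RInt_param (fun th r => polar u th r * wt k r)).
  - apply filter_forall; intros z t _; eexists; apply hd.
  - rewrite Rmin_left, Rmax_right by trivial; intros t ht.
    apply (continuity_2d_pt_ext (fun th r => polar_dth u th r * wt k r)).
    { intros z s; symmetry; apply is_derive_unique, hd. }
    apply cont2_continuity_2d_pt, cont2_mult.
    + now apply cont2_polar_dth.
    + apply cont2_snd, continuous_wt; lra.
  - apply filter_forall; intro z; now apply ex_RInt_ray.
Qed.

(** The Jacobian [r] is included; for [m = 2k] the potential [4m/(r (2r + m)^2)] times [r] is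
    [2k/(r + k)^2]. *)
Definition polar_energy (k : R) (u : R -> R -> R) (th r : R) : R :=
  r * polar_dr u th r ^ 2 + polar_dth u th r ^ 2 / r - 2 * k / (r + k) ^ 2 * polar u th r ^ 2.

Lemma Qform_eq (m Rd : R) (u : R -> R -> R) :
  0 < m -> m / 2 <= Rd ->
  Qform m Rd u = RInt (fun th => RInt (polar_energy (m / 2) u th) (m / 2) Rd) 0 (2 * PI).
Proof.
  intros hm hR; unfold Qform.
  (* The boundary integral drops out because the second fundamental form of the horizon vanishes on
     the normal. *)
  match goal with |- _ + ?X = _ => assert (hb : X = 0) end.
  { rewrite (RInt_ext _ (fun _ => 0)).
    - rewrite RInt_const; apply (scal_zero_r (V := R_NormedModule)).
    - intros th _; cbv zeta; rewrite AdM_NN_eq0; trivial; [eqR; ring|].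
      rewrite !Rpow_mult_distr, <- Rmult_plus_distr_l.
      generalize (sin2_cos2 th); unfold Rsqr; intro e.
      replace (cos th ^ 2 + sin th ^ 2) with 1 by (simpl; lra); ring. }
  rewrite hb, Rplus_0_r.
  apply RInt_ext; intros th _; apply RInt_ext; intros r hr.
  rewrite Rmin_left, Rmax_right in hr by trivial.
  assert (e : cos th ^ 2 = 1 - sin th ^ 2)
    by (generalize (sin2_cos2 th); unfold Rsqr; simpl; lra).
  rewrite (Qdens_eq m hm u _ _ r); [|lra|].
  2:{ rewrite !Rpow_mult_distr, e; ring. }
  unfold polar_energy, polar_dr, polar_dth, polar.
  set (p := d1 u _ _); set (q := d2 u _ _); set (v := u _ _).
  set (c := cos th) in *; set (s := sin th) in *; clearbody p q v c s.
  eqR; field_simplify_eq; [|lra].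
  replace (c ^ 2) with (1 - s ^ 2) by lra.
  ring.
Qed.

(** The radial inequality on each ray reduces the claim to [a], and the mean-zero Poincare
    inequality in the angle finishes it. *)
Lemma Qform_nonneg (m Rd : R) (u : R -> R -> R) :
  0 < m -> m / 2 < Rd -> C1 u ->
  (forall x y, x ^ 2 + y ^ 2 = Rd ^ 2 -> u x y = 0) ->
  RInt (ray_moment (m / 2) Rd u) 0 (2 * PI) = 0 ->
  0 <= Qform m Rd u.
Proof.
  intros hm hR hu hbd hmean.
  rewrite Qform_eq by lra.
  set (k := m / 2) in *; assert (hk : 0 < k) by (unfold k; lra).
  assert (hkR : 0 < k / Rd < 1).
  { split; [apply Rdiv_lt_0_compat; lra|].
    apply Rmult_lt_reg_r with Rd; [lra|]; unfold Rdiv; rewrite Rmult_assoc, Rinv_l by lra; lra. }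
  (* With this [b] the radial bound reads [2 (a'^2 - b^2 a^2)]. The finite radius makes [b < 1/2]
     strict. *)
  set (b := sqrt (1 - k / Rd) / 2).
  assert (hb2 : b ^ 2 = (1 - k / Rd) / 4).
  { unfold b, Rdiv; rewrite Rpow_mult_distr, pow2_sqrt by lra; field; lra. }
  assert (hb : 0 <= b < / 2).
  { unfold b; split.
    - generalize (sqrt_pos (1 - k / Rd)); lra.
    - assert (sqrt (1 - k / Rd) < sqrt 1) by (apply sqrt_lt_1; lra).
      rewrite sqrt_1 in *; lra. }
  generalize PI_RGT_0; intro hpi.
  set (a := ray_moment k Rd u) in *; set (da := ray_moment_dth k Rd u).
  assert (ha : forall x, is_derive a x (da x)) by (intro; apply is_derive_ray_moment; trivial; lra).
  assert (hda : forall x, continuous da x)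
    by (intro; apply continuous_ray_moment_dth; trivial; lra).
  assert (hac : forall x, continuous a x)
    by (intro x; apply (ex_derive_continuous (V := R_NormedModule)); eexists; apply ha).
  assert (hg : forall x, continuous (fun x => da x ^ 2 - b ^ 2 * a x ^ 2) x).
  { intro x; apply (continuous_minus (V := R_NormedModule)).
    + apply (continuous_comp da (fun z => z ^ 2)); trivial.
      apply (ex_derive_continuous (V := R_NormedModule)); auto_derive; trivial.
    + apply (continuous_comp a (fun z => b ^ 2 * z ^ 2)); trivial.
      apply (ex_derive_continuous (V := R_NormedModule)); auto_derive; trivial. }
  assert (hgi : ex_RInt (fun x => da x ^ 2 - b ^ 2 * a x ^ 2) 0 (2 * PI)).
  { apply (ex_RInt_continuous (V := R_CompleteNormedModule)); intros; apply hg. }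
  apply Rle_trans with (RInt (fun x => 2 * (da x ^ 2 - b ^ 2 * a x ^ 2)) 0 (2 * PI)).
  - rewrite (RInt_scal (V := R_CompleteNormedModule)) by trivial.
    apply Rmult_le_pos; [lra|].
    now apply poincare_mean_zero.
  - apply RInt_le; [lra| | |].
    + now apply (ex_RInt_scal (V := R_NormedModule)).
    + apply (ex_RInt_continuous (V := R_CompleteNormedModule)); intros th _.
      apply continuous_RInt_param; [lra|].
      intros y t ht; apply cont2_continuity_2d_pt; unfold polar_energy.
      apply cont2_minus; [apply cont2_plus|].
      1: apply (cont2_mult (fun _ r => r) (fun th r => polar_dr u th r ^ 2)).
      3: apply (cont2_mult (fun th r => polar_dth u th r ^ 2) (fun _ r => / r)).
      5: apply (cont2_mult (fun _ r => 2 * k / (r + k) ^ 2) (fun th r => polar u th r ^ 2)).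
      * apply (cont2_snd (fun z => z)), continuous_id.
      * now apply cont2_sqr, cont2_polar_dr.
      * now apply cont2_sqr, cont2_polar_dth.
      * apply (cont2_snd (fun z => / z)).
        apply (ex_derive_continuous (V := R_NormedModule)); auto_derive; lra.
      * apply (cont2_snd (fun z => 2 * k / (z + k) ^ 2)).
        apply (ex_derive_continuous (V := R_NormedModule)); auto_derive.
        apply Rgt_not_eq, Rmult_lt_0_compat; lra.
      * apply cont2_sqr, cont2_polar, hu.
    + intros th _; rewrite hb2.
      replace (2 * (da th ^ 2 - (1 - k / Rd) / 4 * a th ^ 2))
        with (2 * da th ^ 2 - / 2 * (1 - k / Rd) * a th ^ 2) by (field; lra).
      apply (radial_lower_bound k Rd (polar u th) (polar_dr u th) (polar_dth u th)); trivial.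
      * lra.
      * intros r _; now apply is_derive_polar_r.
      * intros r _; now apply cont2_section, cont2_polar_dr.
      * intros r _; now apply cont2_section, cont2_polar_dth.
      * apply hbd; rewrite !Rpow_mult_distr.
        generalize (sin2_cos2 th); unfold Rsqr; intro e.
        replace (cos th ^ 2) with (1 - sin th ^ 2) by (simpl; lra); ring.
Qed.

(** * Linear combinations and the exclusion of two negative directions *)

Lemma d1_lincomb2 (c0 c1 : R) (u0 u1 : R -> R -> R) (x y : R) : C1 u0 -> C1 u1 ->
  d1 (fun x y => c0 * u0 x y + c1 * u1 x y) x y = c0 * d1 u0 x y + c1 * d1 u1 x y.
Proof.
  intros [e0 _] [e1 _]; unfold d1.
  apply is_derive_unique, (is_derive_plus (V := R_NormedModule)).
  - apply is_derive_scal, Derive_correct, (proj1 (e0 x y)).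
  - apply is_derive_scal, Derive_correct, (proj1 (e1 x y)).
Qed.

Lemma d2_lincomb2 (c0 c1 : R) (u0 u1 : R -> R -> R) (x y : R) : C1 u0 -> C1 u1 ->
  d2 (fun x y => c0 * u0 x y + c1 * u1 x y) x y = c0 * d2 u0 x y + c1 * d2 u1 x y.
Proof.
  intros [e0 _] [e1 _]; unfold d2.
  apply is_derive_unique, (is_derive_plus (V := R_NormedModule)).
  - apply is_derive_scal, Derive_correct, (proj2 (e0 x y)).
  - apply is_derive_scal, Derive_correct, (proj2 (e1 x y)).
Qed.

Lemma cont2_ext (f g : R -> R -> R) (x y : R) :
  (forall a b, f a b = g a b) -> cont2 f x y -> cont2 g x y.
Proof. intros h; apply continuous_ext; intros [a b]; apply h. Qed.

Lemma cont2_lincomb2 (c0 c1 : R) (f g : R -> R -> R) (x y : R) :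
  cont2 f x y -> cont2 g x y -> cont2 (fun a b => c0 * f a b + c1 * g a b) x y.
Proof.
  intros hf hg; apply cont2_plus; apply cont2_mult; trivial; apply continuous_const.
Qed.

Lemma C1_lincomb2 (c0 c1 : R) (u0 u1 : R -> R -> R) : C1 u0 -> C1 u1 ->
  C1 (fun x y => c0 * u0 x y + c1 * u1 x y).
Proof.
  intros h0 h1.
  assert (H0 := h0); assert (H1 := h1).
  destruct H0 as [e0 [c0' [p0 q0]]], H1 as [e1 [c1' [p1 q1]]].
  split; [|split; [|split]]; intros x y.
  - destruct (e0 x y) as [a0 b0], (e1 x y) as [a1 b1].
    split; apply (ex_derive_plus (V := R_NormedModule)); now apply ex_derive_scal.
  - now apply cont2_lincomb2.
  - apply (cont2_ext (fun x y => c0 * d1 u0 x y + c1 * d1 u1 x y)).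
    + intros; now rewrite d1_lincomb2.
    + now apply cont2_lincomb2.
  - apply (cont2_ext (fun x y => c0 * d2 u0 x y + c1 * d2 u1 x y)).
    + intros; now rewrite d2_lincomb2.
    + now apply cont2_lincomb2.
Qed.

Lemma RInt_lincomb2 (f g : R -> R) (a b c0 c1 : R) : ex_RInt f a b -> ex_RInt g a b ->
  RInt (fun x => c0 * f x + c1 * g x) a b = c0 * RInt f a b + c1 * RInt g a b.
Proof.
  intros hf hg.
  apply (is_RInt_unique (V := R_CompleteNormedModule)).
  apply (is_RInt_plus (V := R_NormedModule));
    apply (is_RInt_scal (V := R_NormedModule)),
      (RInt_correct (V := R_CompleteNormedModule)); trivial.
Qed.

Lemma ray_moment_mean_lincomb2 (k Rd c0 c1 : R) (u0 u1 : R -> R -> R) :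
  0 < k -> k <= Rd -> C1 u0 -> C1 u1 ->
  RInt (ray_moment k Rd (fun x y => c0 * u0 x y + c1 * u1 x y)) 0 (2 * PI)
  = c0 * RInt (ray_moment k Rd u0) 0 (2 * PI) + c1 * RInt (ray_moment k Rd u1) 0 (2 * PI).
Proof.
  intros hk hR h0 h1.
  assert (hi : forall u, C1 u -> ex_RInt (ray_moment k Rd u) 0 (2 * PI)).
  { intros u hu; apply (ex_RInt_continuous (V := R_CompleteNormedModule)); intros th _.
    apply (ex_derive_continuous (V := R_NormedModule)); eexists; now apply is_derive_ray_moment. }
  rewrite <- RInt_lincomb2 by auto.
  apply RInt_ext; intros th _; unfold ray_moment.
  rewrite <- RInt_lincomb2 by now apply ex_RInt_ray.
  apply RInt_ext; intros r _; unfold polar; eqR; ring.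
Qed.

(** The mean of [ray_moment] is a linear functional, so some nontrivial combination of two functions
    lies in its kernel, where the form is nonnegative. *)
Lemma not_index_at_least_2 (m Rd : R) : 0 < m -> m / 2 < Rd -> ~ index_at_least m Rd 2.
Proof.
  intros hm hR [u [hadm hneg]].
  assert (h0 := hadm 0%nat ltac:(lia)); assert (h1 := hadm 1%nat ltac:(lia)).
  assert (k0 := smooth2_C1 _ (proj1 h0)); assert (k1 := smooth2_C1 _ (proj1 h1)).
  assert (key : forall c0 c1, c0 <> 0 \/ c1 <> 0 ->
    c0 * RInt (ray_moment (m / 2) Rd (u 0%nat)) 0 (2 * PI)
    + c1 * RInt (ray_moment (m / 2) Rd (u 1%nat)) 0 (2 * PI) <> 0).
  { intros c0 c1 hc e.
    set (c := fun i => match i with O => c0 | _ => c1 end).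
    apply (Rlt_not_le 0 (Qform m Rd (lincomb 2 c u))).
    - apply hneg; destruct hc; [exists 0%nat|exists 1%nat]; split; trivial; lia.
    (* [lincomb] starts from a summand 0, so the two functions agree only pointwise and the
       derivatives are transferred by extensionality. *)
    - assert (eQ : Qform m Rd (lincomb 2 c u)
        = Qform m Rd (fun x y => c0 * u 0%nat x y + c1 * u 1%nat x y)).
      { rewrite !Qform_eq by lra.
        apply RInt_ext; intros th _; apply RInt_ext; intros r _.
        assert (el : forall x y, lincomb 2 c u x y = c0 * u 0%nat x y + c1 * u 1%nat x y)
          by (intros; unfold lincomb, c; ring).
        unfold polar_energy, polar_dr, polar_dth, polar, d1, d2; rewrite el.
        now rewrite !(Derive_ext _ _ _ (fun t => el t _)), !(Derive_ext _ _ _ (fun t => el _ t)). }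
      rewrite eQ; apply Qform_nonneg; trivial.
      + now apply C1_lincomb2.
      + intros x y hxy; rewrite (proj2 h0), (proj2 h1) by trivial; ring.
      + rewrite ray_moment_mean_lincomb2; trivial; lra. }
  (* With means [M0], [M1], the kernel vector is [(1, 0)] if [M0 = 0] and [(M1, - M0)] otherwise. *)
  destruct (Req_dec (RInt (ray_moment (m / 2) Rd (u 0%nat)) 0 (2 * PI)) 0) as [e|e].
  - apply (key 1 0); [left; lra|rewrite e; ring].
  - apply (key (RInt (ray_moment (m / 2) Rd (u 1%nat)) 0 (2 * PI))
               (- RInt (ray_moment (m / 2) Rd (u 0%nat)) 0 (2 * PI))); [right; lra|ring].
Qed.

(** * The lower bound on the index *)

(** Polynomials as syntax: formal differentiation stays inside the type, which supplies the class
    closed under partial derivatives that [smooth2] demands. *)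
Inductive poly2 : Type :=
| PC (c : R) | PX | PY | PA (p q : poly2) | PM (p q : poly2).

Fixpoint peval (p : poly2) (x y : R) : R :=
  match p with
  | PC c => c
  | PX => x
  | PY => y
  | PA p q => peval p x y + peval q x y
  | PM p q => peval p x y * peval q x y
  end.

Fixpoint pdx (p : poly2) : poly2 :=
  match p with
  | PX => PC 1
  | PA p q => PA (pdx p) (pdx q)
  | PM p q => PA (PM (pdx p) q) (PM p (pdx q))
  | _ => PC 0
  end.

Fixpoint pdy (p : poly2) : poly2 :=
  match p with
  | PY => PC 1
  | PA p q => PA (pdy p) (pdy q)
  | PM p q => PA (PM (pdy p) q) (PM p (pdy q))
  | _ => PC 0
  end.

Lemma is_derive_peval_x (p : poly2) (x y : R) :
  is_derive (fun t => peval p t y) x (peval (pdx p) x y).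
Proof.
  induction p; simpl.
  - apply (is_derive_const (V := R_NormedModule)).
  - apply (is_derive_id (K := R_AbsRing)).
  - apply (is_derive_const (V := R_NormedModule)).
  - now apply (is_derive_plus (V := R_NormedModule)).
  - exact (is_derive_mult (fun t => peval p1 t y) (fun t => peval p2 t y) x _ _
      IHp1 IHp2 Rmult_comm).
Qed.

Lemma is_derive_peval_y (p : poly2) (x y : R) :
  is_derive (fun t => peval p x t) y (peval (pdy p) x y).
Proof.
  induction p; simpl.
  - apply (is_derive_const (V := R_NormedModule)).
  - apply (is_derive_const (V := R_NormedModule)).
  - apply (is_derive_id (K := R_AbsRing)).
  - now apply (is_derive_plus (V := R_NormedModule)).
  - exact (is_derive_mult (fun t => peval p1 x t) (fun t => peval p2 x t) y _ _
      IHp1 IHp2 Rmult_comm).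
Qed.

Lemma cont2_peval (p : poly2) (x y : R) : cont2 (peval p) x y.
Proof.
  induction p; simpl.
  - apply continuous_const.
  - apply (cont2_fst (fun t => t)), continuous_id.
  - apply (cont2_snd (fun t => t)), continuous_id.
  - now apply cont2_plus.
  - now apply cont2_mult.
Qed.

Lemma smooth2_peval (p : poly2) (u : R -> R -> R) :
  (forall x y, u x y = peval p x y) -> smooth2 u.
Proof.
  intro h; exists (fun f => exists p, forall x y, f x y = peval p x y).
  split; [now exists p|]; clear p u h.
  intros f [p h]; split; [|split; [|split]].
  - intros x y; apply (cont2_ext (peval p)); [intros; now rewrite h|apply cont2_peval].
  - intros x y; split.
    + apply (ex_derive_ext (fun t => peval p t y)); [intro; now rewrite h|].
      eexists; apply is_derive_peval_x.
    + apply (ex_derive_ext (fun t => peval p x t)); [intro; now rewrite h|].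
      eexists; apply is_derive_peval_y.
  - exists (pdx p); intros x y; unfold d1.
    rewrite (Derive_ext _ (fun t => peval p t y)) by (intro; apply h).
    apply is_derive_unique, is_derive_peval_x.
  - exists (pdy p); intros x y; unfold d2.
    rewrite (Derive_ext _ (fun t => peval p x t)) by (intro; apply h).
    apply is_derive_unique, is_derive_peval_y.
Qed.

(** The potential [2k/(r + k)^2] has integral 1 over [r >= k] and concentrates near the horizon, so
    for large [Rd] it contributes about [Rd^8] against a gradient energy of about [(2/3) Rd^8].
    Without the outer square both would be about [Rd^4], leaving no margin. *)
Definition bump (Rd x y : R) : R := (Rd ^ 2 - x ^ 2 - y ^ 2) ^ 2.

Lemma admissible_bump (Rd : R) : admissible Rd (bump Rd).
Proof.
  split.
  - set (q := PA (PC (Rd ^ 2)) (PA (PM (PC (-1)) (PM PX PX)) (PM (PC (-1)) (PM PY PY)))).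
    apply (smooth2_peval (PM q q)); intros x y; unfold bump; simpl; ring.
  - intros x y h; unfold bump; rewrite <- h; ring.
Qed.

Lemma RInt_radial_bump_neg (k Rd : R) : 0 < k -> 40 * k <= Rd ->
  RInt (fun r => r * (- 4 * r * (Rd ^ 2 - r ^ 2)) ^ 2
                 - 2 * k / (r + k) ^ 2 * ((Rd ^ 2 - r ^ 2) ^ 2) ^ 2) k Rd < 0.
Proof.
  intros hk hR.
  set (f := fun r => _).
  (* Bernoulli: [(Rd^2 - r^2)^4 >= Rd^8 - 4 Rd^6 r^2]; the resulting upper bound of [f] is [G']. *)
  set (G := fun r => 8 * (Rd ^ 4 * r ^ 4 / 2 - 2 * Rd ^ 2 * r ^ 6 / 3 + r ^ 8 / 4)
    + 2 * k * Rd ^ 8 / (r + k) + 8 * k * Rd ^ 6 * r).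
  assert (cf : forall r, 0 < r -> continuous f r).
  { intros r hr; apply (ex_derive_continuous (V := R_NormedModule)); unfold f; auto_derive.
    apply Rgt_not_eq, Rmult_lt_0_compat; lra. }
  assert (h : - G Rd - - G k <= RInt (fun r => - f r) k Rd).
  { apply (RInt_ge_of_derive_le (fun r => - f r) (fun r => - G r)
      (fun r => - (16 * r ^ 3 * (Rd ^ 2 - r ^ 2) ^ 2 - 2 * k * Rd ^ 8 / (r + k) ^ 2
                  + 8 * k * Rd ^ 6)) 0); try lra.
    - intros r hr; apply (continuous_opp (V := R_NormedModule)); now apply cf.
    - intros r hr; unfold G; auto_derive; [lra|field; lra].
    - intros r hr; unfold f.
      apply Ropp_le_contravar.
      (* The gap splits into the Bernoulli remainder and the loss in [r^2/(r + k)^2 <= 1], both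
         nonnegative. *)
      match goal with |- ?L <= ?X => replace X with (L
        + 2 * k * (((Rd ^ 2 - r ^ 2) ^ 4 - Rd ^ 8 + 4 * Rd ^ 6 * r ^ 2) / (r + k) ^ 2
           + 4 * Rd ^ 6 * ((2 * r * k + k ^ 2) / (r + k) ^ 2))) by (field; lra) end.
      assert (0 < (r + k) ^ 2) by (apply pow_lt; lra).
      assert (0 < Rd ^ 6) by (apply pow_lt; lra).
      match goal with |- _ <= _ + 2 * k * (?A / _ + _ * (?C / _)) =>
        assert (0 <= A / (r + k) ^ 2); [apply Rdiv_le_0_compat; trivial|
        assert (0 <= C / (r + k) ^ 2); [apply Rdiv_le_0_compat; trivial; nra|] ] end.
      + replace (_ + _) with (r ^ 4 * (2 * Rd ^ 4 + (2 * Rd ^ 2 - r ^ 2) ^ 2)) by ring.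
        assert (0 < r ^ 4) by (apply pow_lt; lra).
        assert (0 < Rd ^ 4) by (apply pow_lt; lra).
        generalize (pow2_ge_0 (2 * Rd ^ 2 - r ^ 2)); intro.
        apply Rmult_le_pos; lra.
      + match goal with |- _ <= _ + ?P => assert (0 <= P); [|lra] end.
        apply Rmult_le_pos; [lra|]; apply Rplus_le_le_0_compat; trivial.
        apply Rmult_le_pos; lra. }
  rewrite (RInt_opp (V := R_CompleteNormedModule)) in h
    by (apply (ex_RInt_continuous_above f 0); trivial; lra).
  unfold opp in h; simpl in h.
  (* For [Rd >= 40 k], [G Rd] is at most [(2/3 + 2/41 + 1/5) Rd^8], below [Rd^8], while [G k] is at
     least [Rd^8]. *)
  assert (hG : G Rd - G k < 0); [|lra].
  unfold G.
  assert (hR8 : 0 < Rd ^ 8) by (apply pow_lt; lra).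
  assert (hR7 : 0 < Rd ^ 7) by (apply pow_lt; lra).
  assert (hR6 : 0 < Rd ^ 6) by (apply pow_lt; lra).
  assert (e1 : 2 * k * Rd ^ 8 / (Rd + k) <= Rd ^ 8 * (2 / 41)).
  { replace (2 * k * Rd ^ 8 / (Rd + k)) with (Rd ^ 8 * (2 * k / (Rd + k))) by (field; lra).
    apply Rmult_le_compat_l; [lra|].
    apply Rmult_le_reg_r with (Rd + k); [lra|].
    unfold Rdiv; rewrite Rmult_assoc, Rinv_l by lra; lra. }
  assert (e2 : 8 * k * Rd ^ 6 * Rd <= Rd ^ 8 / 5).
  { replace (8 * k * Rd ^ 6 * Rd) with (8 * k * Rd ^ 7) by ring.
    replace (Rd ^ 8 / 5) with (Rd / 5 * Rd ^ 7) by field.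
    apply Rmult_le_compat_r; lra. }
  assert (e3 : 2 * k * Rd ^ 8 / (k + k) = Rd ^ 8) by (field; lra).
  assert (e4 : 0 <= 8 * k * Rd ^ 6 * k).
  { apply Rmult_le_pos; [|lra]. apply Rmult_le_pos; lra. }
  assert (e5 : 0 <= Rd ^ 4 * k ^ 4 / 2 - 2 * Rd ^ 2 * k ^ 6 / 3 + k ^ 8 / 4).
  { replace (_ + _) with (k ^ 4 * ((Rd ^ 2 - 2 / 3 * k ^ 2) ^ 2 / 2 + k ^ 4 * (1 / 36))) by field.
    assert (0 < k ^ 4) by (apply pow_lt; lra).
    generalize (pow2_ge_0 (Rd ^ 2 - 2 / 3 * k ^ 2)); intro.
    apply Rmult_le_pos; lra. }
  replace (8 * (Rd ^ 4 * Rd ^ 4 / 2 - 2 * Rd ^ 2 * Rd ^ 6 / 3 + Rd ^ 8 / 4))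
    with (Rd ^ 8 * (2 / 3)) by field.
  rewrite e3; lra.
Qed.

Lemma index_at_least_1 (m Rd : R) : 0 < m -> 20 * m <= Rd -> index_at_least m Rd 1.
Proof.
  intros hm hR; exists (fun _ => bump Rd); split.
  { intros; apply admissible_bump. }
  intros c [i [hi hc]].
  replace i with 0%nat in hc by lia.
  rewrite Qform_eq by lra.
  set (f := fun r => r * (- 4 * r * (Rd ^ 2 - r ^ 2)) ^ 2
                 - 2 * (m / 2) / (r + m / 2) ^ 2 * ((Rd ^ 2 - r ^ 2) ^ 2) ^ 2).
  (* The test function is radial, so the inner integral is the same on every ray. *)
  rewrite (RInt_ext _ (fun _ => c 0%nat ^ 2 * RInt f (m / 2) Rd)).
  - rewrite RInt_const.
    change ((2 * PI - 0) * (c 0%nat ^ 2 * RInt f (m / 2) Rd) < 0).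
    assert (hI : RInt f (m / 2) Rd < 0) by (apply RInt_radial_bump_neg; lra).
    assert (0 < c 0%nat ^ 2) by (apply pow2_gt_0, hc).
    assert (0 < c 0%nat ^ 2 * - RInt f (m / 2) Rd) by (apply Rmult_lt_0_compat; lra).
    assert (0 < 2 * PI * (c 0%nat ^ 2 * - RInt f (m / 2) Rd))
      by (apply Rmult_lt_0_compat; [generalize PI_RGT_0|]; lra).
    lra.
  - intros th _.
    rewrite <- (RInt_scal (V := R_CompleteNormedModule) f).
    2:{ apply (ex_RInt_continuous_above f 0); try lra.
        intros r hr; apply (ex_derive_continuous (V := R_NormedModule)); unfold f; auto_derive.
        apply Rgt_not_eq, Rmult_lt_0_compat; lra. }
    apply RInt_ext; intros r hr.
    rewrite Rmin_left, Rmax_right in hr by lra.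
    assert (e : sin th ^ 2 = 1 - cos th ^ 2)
      by (generalize (sin2_cos2 th); unfold Rsqr; simpl; lra).
    assert (E1 : forall x y, d1 (lincomb 1 c (fun _ => bump Rd)) x y
        = c 0%nat * (- 4 * x * (Rd ^ 2 - x ^ 2 - y ^ 2))).
    { intros x y; unfold d1, lincomb, bump; apply is_derive_unique.
      auto_derive; trivial; ring. }
    assert (E2 : forall x y, d2 (lincomb 1 c (fun _ => bump Rd)) x y
        = c 0%nat * (- 4 * y * (Rd ^ 2 - x ^ 2 - y ^ 2))).
    { intros x y; unfold d2, lincomb, bump; apply is_derive_unique.
      auto_derive; trivial; ring. }
    unfold polar_energy, polar_dr, polar_dth, polar; rewrite E1, E2.
    match goal with |- ?X = _ => change (X = c 0%nat ^ 2 * f r) end.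
    unfold lincomb, bump, f.
    replace (Rd ^ 2 - (r * cos th) ^ 2 - (r * sin th) ^ 2) with (Rd ^ 2 - r ^ 2)
      by (rewrite !Rpow_mult_distr, e; ring).
    replace (c 0%nat * (- 4 * (r * cos th) * (Rd ^ 2 - r ^ 2)) * cos th
             + c 0%nat * (- 4 * (r * sin th) * (Rd ^ 2 - r ^ 2)) * sin th)
      with (c 0%nat * (- 4 * r * (Rd ^ 2 - r ^ 2)) * (cos th ^ 2 + sin th ^ 2)) by ring.
    rewrite e; field; lra.
Qed.

Theorem theorem1p1 (m : R) (hm : 0 < m) : morse_index m 1.
Proof.
  (* The threshold [20 m = 40 k] comes from the test function; the upper bound holds for every
     [Rd > m/2]. *)
  exists (20 * m); split; [lra|]; intros Rd hR; split.
  - now apply index_at_least_1.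
  - apply not_index_at_least_2; lra.
Qed.
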